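(* Define $\tau_0,\tau_1:\mathbb{Z}^2\to\mathbb{Z}^2$ by $\tau_0[a,b]=[a,a+b]$ and $\tau_1[a,b]=[b,a+b]$. For a binary code $\mathbf{c}=x_1x_2\cdots x_n$ with each $x_i\in\{0,1\}$, set $T[\mathbf{c}]=\tau_{x_n}\tau_{x_{n-1}}\cdots\tau_{x_1}[1,2]$, so that $\tau_{x_1}$ is applied first. Let $\mathrm{refl}(\mathbf{c})=x_nx_{n-1}\cdots x_1$. Then for every binary code $\mathbf{c}$, \[\|T[\mathbf{c}]\| = \|T[\mathrm{refl}(\mathbf{c})]\|,\] where $\|[a,b]\|=|a|+|b|$.
   Context: All pairs $T[\mathbf{c}]$ have positive entries, so $\|T[\mathbf{c}]\|$ is the sum of the two entries. *)

(* Defs.v *)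
From mathcomp Require Import all_boot all_order all_algebra.

Set Implicit Arguments.
Unset Strict Implicit.
Unset Printing Implicit Defensive.

Import Order.TTheory GRing.Theory Num.Theory.
Local Open Scope ring_scope.

Definition tau0 (v : int * int) : int * int := (v.1, v.1 + v.2).

Definition tau1 (v : int * int) : int * int := (v.2, v.1 + v.2).

(* A binary code x_1 x_2 ... x_n is the sequence [:: x_1; ...; x_n] of
   booleans, with false for the digit 0 and true for the digit 1. *)
Definition code := seq bool.

Definition tau (x : bool) : int * int -> int * int := if x then tau1 else tau0.

(* The left fold applies tau x_1 first and tau x_n last. *)
Definition T (c : code) : int * int := foldl (fun v x => tau x v) (1, 2) c.

Definition refl (c : code) : code := rev c.

Definition norm1 (v : int * int) : int := `|v.1| + `|v.2|.

(* Main.v *)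
(* The symmetric bilinear form B(v, w) = v1 w2 + v2 w1 - v1 w1 makes both tau_0
   and tau_1 self-adjoint, and B([1,2], w) = w1 + w2.  Moving the maps of a code
   from one argument of B to the other reverses their order. *)
Require Import Defs.
From mathcomp Require Import all_boot all_order all_algebra.
From mathcomp Require Import ring.

Import Order.TTheory GRing.Theory Num.Theory.
Local Open Scope ring_scope.

Definition form (v w : int * int) : int :=
  v.1 * w.2 + v.2 * w.1 - v.1 * w.1.

Lemma formC v w : form v w = form w v.
Proof. by rewrite /form; ring. Qed.

Lemma form_tau x v w : form (tau x v) w = form v (tau x w).
Proof. by case: x; rewrite /form /tau /tau0 /tau1 /=; ring. Qed.

Lemma form_foldl_tau (c : code) v w :
  form (foldl (fun u x => tau x u) v c) w =
  form v (foldl (fun u x => tau x u) w (rev c)).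
Proof.
elim: c v => [|x c IHc] v //=.
(* After [IHc] only [tau x] remains on [v]; moved across, it acts last on [w], as the final digit of
   [rev (x :: c)]. *)
by rewrite IHc form_tau rev_cons foldl_rcons.
Qed.

(** Lets [norm1] lose its absolute values and become linear on the vectors [T c]. *)
Lemma T_ge0 c : (0 <= (T c).1) && (0 <= (T c).2).
Proof.
elim/last_ind: c => [|c x /andP[ge1 ge2]] //.
by rewrite /T foldl_rcons; case: x; rewrite /= ?ge1 ?ge2 addr_ge0.
Qed.

Lemma norm1_T c : norm1 (T c) = form (1, 2) (T c).
Proof.
have /andP[ge1 ge2] := T_ge0 c.
by rewrite /norm1 !ger0_norm // /form /=; ring.
Qed.

Theorem theorem3p4 (c : code) : norm1 (T c) = norm1 (T (refl c)).
(* [(1, 2)] is both the seed of [T] and the vector that represents the norm, so the maps moved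
   across build [T (refl c)]. *)
Proof. by rewrite !norm1_T formC form_foldl_tau. Qed.
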